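(* Let $\rho$ be a convex risk measure on $\mathcal X$, let $\gamma_A,\gamma_B>0$, put $\gamma_C=\gamma_A+\gamma_B$, and let $\rho_{\gamma_A},\rho_{\gamma_B},\rho_{\gamma_C}$ be the $\gamma$-tolerant risk measures generated by $\rho$. Let $X_T^A,X_T^B\in\mathcal X$. Then $$\inf_{F\in\mathcal X}\big\{\rho_{\gamma_A}(X_T^A-F)+\rho_{\gamma_B}(X_T^B+F)\big\}=\rho_{\gamma_C}(X_T^A+X_T^B),$$ and the infimum is attained at $$F^*=\frac{\gamma_B}{\gamma_A+\gamma_B}X_T^A-\frac{\gamma_A}{\gamma_A+\gamma_B}X_T^B$$ (an optimal structure being determined up to an additive constant: $F^*+m$ is also optimal for every $m\in\mathbb R$).
   Context: $\mathcal X$ denotes either the space of bounded measurable real functions on a measurable space $(\Omega,\mathcal F)$, or $\mathbb L_\infty(\mathbb P)$ for a probability space $(\Omega,\mathcal F,\mathbb P)$ (in which case all (in)equalities are $\mathbb P$-a.s.). A convex risk measure is a map $\rho:\mathcal X\to\mathbb R$ that is convex, decreasing ($\Phi\le\Psi\Rightarrow\rho(\Phi)\ge\rho(\Psi)$) and translation invariant ($\rho(\Phi+m)=\rho(\Phi)-m$ for $m\in\mathbb R$). For $\gamma>0$, the $\gamma$-tolerant risk measure generated by $\rho$ is $\rho_\gamma(\Psi)=\gamma\,\rho(\Psi/\gamma)$. *)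

(* Defs.v *)
From HB Require Import structures.
From mathcomp Require Import all_boot all_order all_algebra.
From mathcomp Require Import all_classical all_reals all_analysis.
From mathcomp Require Import measurable_realfun ess_sup_inf.

Set Implicit Arguments.
Unset Strict Implicit.
Unset Printing Implicit Defensive.

Import Order.TTheory GRing.Theory Num.Theory.
Import numFieldNormedType.Exports.

Local Open Scope classical_set_scope.
Local Open Scope ring_scope.

Section bounded_measurable.
Context d (T : measurableType d) (R : realType).

Definition bmfun_pred : {pred T -> R} :=
  mem [set f : T -> R | measurable_fun setT f /\ bounded_fun (f : T -> R^o)].

Lemma bmfun_submod_closed : submod_closed bmfun_pred.
Proof.
split.
  rewrite inE; split; first exact: measurable_cst.
  by exists 0; split=> // M M0 x _ /=; rewrite normr0 ltW.
move=> a f g; rewrite !inE => -[mf [M [Mr fM]]] [mg [N [Nr gN]]]; split.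
  by apply: measurable_funD => //; exact: measurable_funM.
exists (`|a| * (`|M| + 1) + (`|N| + 1)); split; first exact: num_real.
move=> x /ltW xge y _; apply: le_trans xge.
rewrite (le_trans (ler_normD _ _))// lerD//.
  by rewrite normrM ler_wpM2l// fM// (le_lt_trans (ler_norm _))// ltrDl.
by rewrite gN// (le_lt_trans (ler_norm _))// ltrDl.
Qed.

HB.instance Definition _ :=
  GRing.isSubmodClosed.Build _ _ bmfun_pred bmfun_submod_closed.

Record bmfun := BMFun { bmfun_val :> T -> R; _ : bmfun_val \in bmfun_pred }.

HB.instance Definition _ := [isSub for bmfun_val].
HB.instance Definition _ := [Choice of bmfun by <:].
HB.instance Definition _ := [SubChoice_isSubLmodule of bmfun by <:].

End bounded_measurable.

(* The library provides LspaceType mu p1 (functions of finite L^p norm modulo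
   almost everywhere equality) as a bare type. This section equips it with its
   vector space structure for p = +oo, operations being those of representatives. *)
Section Linfty_lmodType.
Context d (T : measurableType d) (R : realType).
Variables (mu : {measure set T -> \bar R}) (p1 : (1 <= +oo :> \bar R)%E).

Local Notation Lfun := (LfunType mu p1).
Local Notation Lspace := (LspaceType mu p1).
Local Notation mfun_mu := {mfun_ mu, T >-> measurableTypeR R}.
Local Open Scope quotient_scope.

(* The elements of Lspace are classes of functions into measurableTypeR R, whose
   sigma-algebra is that of R but carries another display; hence the repacking. *)
Let cls_meas (f : Lfun) : measurable_fun setT (f : T -> measurableTypeR R).
Proof. exact: (@measurable_funPT _ _ _ _ f). Qed.

Let cls_mfun (f : Lfun) : {mfun T >-> measurableTypeR R} :=
  HB.pack (f : T -> measurableTypeR R)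
    (isMeasurableFun.Build _ _ T (measurableTypeR R) f (cls_meas f)).

Let cls (f : Lfun) : mfun_mu := \pi_mfun_mu (cls_mfun f).

Let cls_ae (f : Lfun) : \forall x \ae mu, cls f x = f x.
Proof.
have /eqmodP/asboolP : repr (cls f) = cls_mfun f %[mod mfun_mu] by exact: reprK.
by apply: filterS => x; apply.
Qed.

Let cls_finite (f : Lfun) : finite_norm mu +oo%E (cls f).
Proof.
have := Lfunction_finite p1 f; rewrite /finite_norm unlock /=.
rewrite (@eq_ess_sup _ _ _ mu (abse \o (EFin \o cls f))
  (abse \o (EFin \o f)))//.
by apply: filterS (cls_ae f) => x /= ->.
Qed.

Definition Lspace_class (f : Lfun) : Lspace :=
  HB.pack (cls f)
    (isFinLebesgue.Build d T R mu +oo%E p1 (cls f) (cls_finite f)).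

Let repr_meas (x : Lspace) : measurable_fun setT (x : T -> R).
Proof. exact: (@measurable_funPT _ _ _ _ (repr (x : mfun_mu))). Qed.

Let repr_Lfun (x : Lspace) : (x : T -> R) \in hoelder.Lfun mu +oo%E.
Proof.
rewrite inE; apply/andP; split; rewrite inE; first exact: repr_meas.
exact: (@Lebesgue_finite _ _ _ _ _ _ x).
Qed.

Definition Lspace_repr (x : Lspace) : Lfun := Lfun_Sub p1 (repr_Lfun x).

Lemma Lspace_reprE (x : Lspace) : Lspace_repr x = x :> (T -> R).
Proof. by []. Qed.

Lemma Lspace_classE (f : Lfun) : \forall x \ae mu, Lspace_class f x = f x.
Proof. exact: cls_ae. Qed.

Lemma Lspace_eqP (x y : Lspace) : x = y <-> \forall t \ae mu, x t = y t.
Proof.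
split=> [->|xy]; first exact: aeW.
have : (x : mfun_mu) = y.
  rewrite -[LHS]reprK -[RHS]reprK; apply/eqmodP/asboolP.
  by apply: filterS xy.
case: x y xy => [x [[x1]]] [y [[y1]]] /= _ xy; subst y.
by rewrite (Prop_irrelevance x1 y1).
Qed.


HB.instance Definition _ := gen_eqMixin Lspace.
HB.instance Definition _ := gen_choiceMixin Lspace.

Definition Lspace_zero : Lspace := Lspace_class 0.
Definition Lspace_opp (x : Lspace) : Lspace := Lspace_class (- Lspace_repr x).
Definition Lspace_add (x y : Lspace) : Lspace :=
  Lspace_class (Lspace_repr x + Lspace_repr y).
Definition Lspace_scale (a : R) (x : Lspace) : Lspace :=
  Lspace_class (a *: Lspace_repr x).

Lemma Lspace_zeroE : \forall t \ae mu, Lspace_zero t = 0.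
Proof. exact: Lspace_classE. Qed.

Lemma Lspace_oppE x : \forall t \ae mu, Lspace_opp x t = - x t.
Proof. exact: Lspace_classE. Qed.

Lemma Lspace_addE x y : \forall t \ae mu, Lspace_add x y t = x t + y t.
Proof. exact: Lspace_classE. Qed.

Lemma Lspace_scaleE a x : \forall t \ae mu, Lspace_scale a x t = a * x t.
Proof. exact: Lspace_classE. Qed.

Let addA : associative Lspace_add.
Proof.
move=> x y z; apply/Lspace_eqP; near=> t.
have -> : Lspace_add x (Lspace_add y z) t = x t + Lspace_add y z t
  by near: t; exact: Lspace_addE.
have -> : Lspace_add y z t = y t + z t by near: t; exact: Lspace_addE.
have -> : Lspace_add (Lspace_add x y) z t = Lspace_add x y t + z t
  by near: t; exact: Lspace_addE.
have -> : Lspace_add x y t = x t + y t by near: t; exact: Lspace_addE.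
by rewrite addrA.
Unshelve. all: by end_near. Qed.

Let addC : commutative Lspace_add.
Proof. by move=> x y; rewrite /Lspace_add addrC. Qed.

Let add0 : left_id Lspace_zero Lspace_add.
Proof.
move=> x; apply/Lspace_eqP; apply: filterS2 (Lspace_addE Lspace_zero x) Lspace_zeroE.
by move=> t -> ->; rewrite add0r.
Qed.

Let addN : left_inverse Lspace_zero Lspace_opp Lspace_add.
Proof.
move=> x; apply/Lspace_eqP.
apply: filterS3 (Lspace_addE (Lspace_opp x) x) (Lspace_oppE x) Lspace_zeroE.
by move=> t -> -> ->; rewrite addNr.
Qed.

HB.instance Definition _ := GRing.isZmodule.Build Lspace addA addC add0 addN.

Let scaleA a b x :
  Lspace_scale a (Lspace_scale b x) = Lspace_scale (a * b) x.
Proof.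
apply/Lspace_eqP.
apply: filterS3 (Lspace_scaleE a (Lspace_scale b x)) (Lspace_scaleE b x)
  (Lspace_scaleE (a * b) x).
by move=> t -> -> ->; rewrite mulrA.
Qed.

Let scale1 : left_id 1 Lspace_scale.
Proof.
move=> x; apply/Lspace_eqP; apply: filterS (Lspace_scaleE 1 x).
by move=> t ->; rewrite mul1r.
Qed.

Let scaleDr : right_distributive Lspace_scale +%R.
Proof.
move=> a x y; apply/Lspace_eqP; near=> t.
have -> : Lspace_scale a (x + y) t = a * (x + y) t
  by near: t; exact: Lspace_scaleE.
have -> : (x + y) t = x t + y t by near: t; exact: Lspace_addE.
have -> : (Lspace_scale a x + Lspace_scale a y) t =
    Lspace_scale a x t + Lspace_scale a y t
  by near: t; exact: Lspace_addE.
have -> : Lspace_scale a x t = a * x t by near: t; exact: Lspace_scaleE.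
have -> : Lspace_scale a y t = a * y t by near: t; exact: Lspace_scaleE.
by rewrite mulrDr.
Unshelve. all: by end_near. Qed.

Let scaleDl x : {morph Lspace_scale^~ x : a b / a + b}.
Proof.
move=> a b; apply/Lspace_eqP; near=> t.
have -> : Lspace_scale (a + b) x t = (a + b) * x t
  by near: t; exact: Lspace_scaleE.
have -> : (Lspace_scale a x + Lspace_scale b x) t =
    Lspace_scale a x t + Lspace_scale b x t
  by near: t; exact: Lspace_addE.
have -> : Lspace_scale a x t = a * x t by near: t; exact: Lspace_scaleE.
have -> : Lspace_scale b x t = b * x t by near: t; exact: Lspace_scaleE.
by rewrite mulrDl.
Unshelve. all: by end_near. Qed.

HB.instance Definition _ :=
  GRing.Zmodule_isLmodule.Build R Lspace scaleA scale1 scaleDr scaleDl.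

Lemma Lspace_classD (f g : Lfun) :
  Lspace_class (f + g) = Lspace_class f + Lspace_class g.
Proof.
apply/Lspace_eqP; near=> t.
rewrite (near (Lspace_classE (f + g)) t)//.
rewrite (near (Lspace_addE (Lspace_class f) (Lspace_class g)) t)//.
by rewrite (near (Lspace_classE f) t)// (near (Lspace_classE g) t).
Unshelve. all: by end_near. Qed.

End Linfty_lmodType.

Section payoffs.
Context d (T : measurableType d) (R : realType).

Lemma bmfun_cst_subproof (c : R) : (cst c : T -> R) \in @bmfun_pred d T R.
Proof.
rewrite inE; split; first exact: measurable_cst.
by exists `|c|; split=> [|M /ltW cM x _ //]; exact: num_real.
Qed.

Definition bmfun_cst (c : R) : bmfun T R := BMFun (bmfun_cst_subproof c).

Definition bmfun_le (f g : bmfun T R) : Prop := forall t, f t <= g t.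

Definition Linfty (P : probability T R) : Type := LspaceType P (leey 1%E).

HB.instance Definition _ (P : probability T R) := GRing.Lmodule.on (Linfty P).

Lemma Lfun_infty_cst_subproof (P : probability T R) (c : R) :
  (cst c : T -> R) \in Lfun P +oo%E.
Proof.
rewrite inE; apply/andP; split; rewrite inE; first exact: measurable_cst.
rewrite /= /finite_norm unlock /=; case: ifPn => // P0.
by rewrite (_ : _ \o _ = cst `|c|%:E)// ess_sup_cst// ltry.
Qed.

Definition Linfty_cst (P : probability T R) (c : R) : Linfty P :=
  Lspace_class (Lfun_Sub (leey 1%E) (Lfun_infty_cst_subproof P c)).

Definition Linfty_le (P : probability T R) (f g : Linfty P) : Prop :=
  \forall t \ae P, f t <= g t.

(* The two choices of the space of payoffs on (T, d): bounded measurable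
   functions with the pointwise order, or L_oo(P) with the P-a.s. order. *)
Variant payoff_space := BoundedMeasurable | EssBounded of probability T R.

Definition payoff (X : payoff_space) : lmodType R :=
  match X with
  | BoundedMeasurable => bmfun T R
  | EssBounded P => Linfty P
  end.

Definition payoff_cst (X : payoff_space) : R -> payoff X :=
  match X with
  | BoundedMeasurable => bmfun_cst
  | EssBounded P => Linfty_cst P
  end.

Definition payoff_le (X : payoff_space) : payoff X -> payoff X -> Prop :=
  match X with
  | BoundedMeasurable => bmfun_le
  | EssBounded P => @Linfty_le P
  end.

Record convex_risk_measure (X : payoff_space) (rho : payoff X -> R) : Prop := {
  crm_convex : convex_function setT rho;
  crm_decreasing : forall Phi Psi, payoff_le Phi Psi -> rho Psi <= rho Phi;
  crm_translation : forall Phi m, rho (Phi + payoff_cst X m) = rho Phi - m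
}.

Definition tolerant (X : payoff_space) (rho : payoff X -> R) (gamma : R)
    (Psi : payoff X) : R :=
  gamma * rho (gamma^-1 *: Psi).

End payoffs.

(* Main.v *)
(* Write c = gammaA + gammaB. Any two positions sum to c times the convex
   combination, with weights gammaA / c and gammaB / c, of their rescalings by
   1 / gammaA and 1 / gammaB; convexity of rho thus gives
   rho_c (Y + Z) <= rho_gammaA Y + rho_gammaB Z, which bounds J from below.
   At Fstar both agents hold shares, gammaA / c and gammaB / c, of the total
   position, and the two rescalings coincide, so that equality holds. *)
Require Import Defs.
From mathcomp Require Import all_boot all_order all_algebra.
From mathcomp Require Import all_classical all_reals all_analysis.
From mathcomp Require Import ring lra.

Import Order.TTheory GRing.Theory Num.Theory.
Local Open Scope classical_set_scope.
Local Open Scope ring_scope.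

(** Lets a constant pass through the rescaling inside [tolerant]. For [EssBounded], constants are
    classes, so the identity is checked almost surely on representatives. *)
Lemma payoff_cstZ (d : measure_display) (T : measurableType d) (R : realType)
    (X : payoff_space T R) (a m : R) :
  a *: payoff_cst X m = payoff_cst X (a * m).
Proof.
case: X => [|P] /=; first exact: val_inj.
apply/Lspace_eqP.
apply: filterS3 (Lspace_scaleE a (Linfty_cst P m))
  (Lspace_classE (Lfun_Sub (leey 1%E) (Lfun_infty_cst_subproof P m)))
  (Lspace_classE (Lfun_Sub (leey 1%E) (Lfun_infty_cst_subproof P (a * m)))).
by move=> t -> -> ->.
Qed.

Lemma payoff_cstN (d : measure_display) (T : measurableType d) (R : realType)
    (X : payoff_space T R) (m : R) : - payoff_cst X m = payoff_cst X (- m).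
Proof. by rewrite -scaleN1r payoff_cstZ mulN1r. Qed.

Section tolerant_theory.
Context (d : measure_display) (T : measurableType d) (R : realType).
Variables (X : payoff_space T R) (rho : payoff X -> R).
Implicit Types (a b c m : R) (Y Z : payoff X).

(** Rescaling the share by [a^-1] leaves [c^-1 *: Y], whatever [a] is; only the outer factor still
    sees [a]. *)
Lemma tolerant_share a c Y : a != 0 -> c != 0 ->
  tolerant rho a ((a / c) *: Y) = a / c * tolerant rho c Y.
Proof.
by move=> a0 c0; rewrite /tolerant scalerA mulKf// mulrA divfK.
Qed.

Hypothesis rho_crm : convex_risk_measure rho.

Lemma tolerant_translation a Y m : a != 0 ->
  tolerant rho a (Y + payoff_cst X m) = tolerant rho a Y - m.
Proof.
move=> a0; rewrite /tolerant scalerDr payoff_cstZ (crm_translation rho_crm).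
by rewrite mulrBr mulVKf.
Qed.

(** Restates [crm_convex], whose weights are bundled with their bounds, for a plain real weight. *)
Lemma crm_convex_le t Y Z : 0 <= t <= 1 ->
  rho (t *: Y + (1 - t) *: Z) <= t * rho Y + (1 - t) * rho Z.
Proof.
case/andP=> t0 t1.
have := crm_convex rho_crm (Itv01 t0 t1) (mem_set (I : setT Y))
  (mem_set (I : setT Z)).
exact.
Qed.

Lemma le_tolerantD a b Y Z : 0 < a -> 0 < b ->
  tolerant rho (a + b) (Y + Z) <= tolerant rho a Y + tolerant rho b Z.
Proof.
move=> a0 b0; have c0 : 0 < a + b by exact: addr_gt0.
have wb : 1 - a / (a + b) = b / (a + b) by field; lra.
have wa01 : 0 <= a / (a + b) <= 1.
  apply/andP; split; first by rewrite divr_ge0 ?ltW.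
  by rewrite ler_pdivrMr// mul1r lerDl ltW.
have := crm_convex_le _ (a^-1 *: Y) (b^-1 *: Z) wa01.
(* Each weight cancels against its rescaling, leaving the common coefficient [(a + b)^-1] on [Y] and
   [Z]. *)
rewrite wb !scalerA ![_ / (a + b) * _^-1]mulrAC !divff ?gt_eqF// !mul1r.
rewrite -scalerDr => /(ler_wpM2l (ltW c0)) /le_trans; apply.
(* What remains is an equality: the factor [a + b] clears the denominators of the weights. *)
rewrite /tolerant le_eqVlt; apply/orP; left; apply/eqP.
by field; lra.
Qed.

End tolerant_theory.

Theorem theorem4p1 (d : measure_display) (T : measurableType d) (R : realType)
    (X : payoff_space T R) (rho : payoff X -> R)
    (rho_crm : convex_risk_measure rho)
    (gammaA gammaB : R) (gammaA_gt0 : 0 < gammaA) (gammaB_gt0 : 0 < gammaB)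
    (XA XB : payoff X) :
  let gammaC := gammaA + gammaB in
  let J := fun F : payoff X =>
    tolerant rho gammaA (XA - F) + tolerant rho gammaB (XB + F) in
  let Fstar : payoff X :=
    (gammaB / (gammaA + gammaB)) *: XA - (gammaA / (gammaA + gammaB)) *: XB in
  [/\ ereal_inf [set (J F)%:E | F in [set: payoff X]]
        = (tolerant rho gammaC (XA + XB))%:E,
      (J Fstar)%:E = ereal_inf [set (J F)%:E | F in [set: payoff X]]
    & forall m : R, (J (Fstar + payoff_cst X m))%:E
        = ereal_inf [set (J F)%:E | F in [set: payoff X]]].
Proof.
move=> gammaC J Fstar.
have gA0 : gammaA != 0 by rewrite gt_eqF.
have gB0 : gammaB != 0 by rewrite gt_eqF.
have gC0 : gammaC != 0 by rewrite gt_eqF// addr_gt0.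
have wAB : gammaA / gammaC + gammaB / gammaC = 1 by rewrite -mulrDl divff.
have J_ge F : tolerant rho gammaC (XA + XB) <= J F.
  have -> : XA + XB = (XA - F) + (XB + F) by rewrite addrACA addNr addr0.
  exact: le_tolerantD.
have shareA : XA - Fstar = (gammaA / gammaC) *: (XA + XB).
  (* Splitting [XA] by [wAB] makes its [gammaB] part cancel against that of [Fstar]. *)
  rewrite /Fstar -/gammaC opprB addrCA -{1}[XA]scale1r -wAB scalerDl addrK.
  by rewrite addrC scalerDr.
have shareB : XB + Fstar = (gammaB / gammaC) *: (XA + XB).
  rewrite /Fstar -/gammaC addrCA -{1}[XB]scale1r -wAB scalerDl addrAC subrr.
  by rewrite add0r scalerDr.
have JFstar : J Fstar = tolerant rho gammaC (XA + XB).
  by rewrite /J shareA shareB !tolerant_share// -mulrDl wAB mul1r.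
(* The cash [m] moves from one agent to the other, so its two contributions are opposite. *)
have J_translation F m : J (F + payoff_cst X m) = J F.
  rewrite /J opprD !addrA payoff_cstN !tolerant_translation//.
  by rewrite opprK addrACA subrr addr0.
have infJ : ereal_inf [set (J F)%:E | F in [set: payoff X]] =
    (tolerant rho gammaC (XA + XB))%:E.
  apply/le_anti/andP; split.
    by apply: ereal_inf_lbound; exists Fstar => //; rewrite JFstar.
  by apply: le_ereal_inf_tmp => _ [F _ <-]; rewrite lee_fin.
by split=> [||m]; rewrite infJ ?J_translation ?JFstar.
Qed.
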